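(* For integers $r \geq 3$ and $n \geq r$, the number $S_r(n)$ of $r$-monotone colorings of $\mathcal{K}^r_n$ satisfies \[2^{n^{r-1}/r^{4r}} \leq S_r(n) \leq 2^{2^{r-2}n^{r-1}/(r-1)!}.\]
   Context: $\mathcal{K}^r_n$ denotes the complete $r$-uniform hypergraph on vertex set $\{1,\dots,n\}$ ordered naturally. An $r$-monotone coloring of $\mathcal{K}^r_n$ is a map $c$ from the $r$-subsets of $\{1,\dots,n\}$ to $\{-1,+1\}$ such that for every $(r+1)$-tuple $v_1<\dots<v_{r+1}$, writing $S=(v_1,\dots,v_{r+1})$ and $S^{(i)}$ for the $r$-set obtained by deleting $v_i$, for all $1\le i<j<k\le r+1$ we have $c(S^{(k)})\le c(S^{(j)})\le c(S^{(i)})$ or $c(S^{(k)})\ge c(S^{(j)})\ge c(S^{(i)})$ (i.e., the sequence $(c(S^{(r+1)}),\dots,c(S^{(1)}))$ changes sign at most once). *)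

(* Defs.v *)
From HB Require Import structures.
From mathcomp Require Import all_boot all_order all_algebra.
From mathcomp Require Import all_reals all_analysis.

Set Implicit Arguments.
Unset Strict Implicit.
Unset Printing Implicit Defensive.

Import Order.TTheory GRing.Theory Num.Theory.

Local Open Scope ring_scope.

(* The vertices 1, ..., n are represented by 0, ..., n - 1. *)
Definition edge (n r : nat) : finType := {A : {set 'I_n} | #|A| == r}.

Definition color : finType := seq_sub [:: -1; 1 : int].

Definition coloring (n r : nat) : finType := {ffun edge n r -> color}.

(* As enum lists 'I_n increasingly, this is the (i + 1)-st smallest element
   of S; see vertex_lt. *)
Definition vertex (n m : nat) (S : edge n m) (i : 'I_m) : 'I_n :=
  enum_val (cast_ord (esym (eqP (valP S))) i).

Lemma vertex_in (n m : nat) (S : edge n m) (i : 'I_m) :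
  vertex S i \in val S.
Proof. exact: enum_valP. Qed.

Lemma vertex_lt (n m : nat) (S : edge n m) (i j : 'I_m) :
  (i < j)%N -> (vertex S i < vertex S j)%N.
Proof.
move=> ltij; pose x0 := vertex S i.
have size_S : size (enum (val S)) = m by rewrite -cardE (eqP (valP S)).
rewrite /vertex !(enum_val_nth x0) /=.
have srt : sorted ltn (map val (enum (val S))).
  apply: (subseq_sorted ltn_trans (s2 := map val (enum 'I_n))).
    by apply: map_subseq; rewrite [enum 'I_n]enumT; apply: filter_subseq.
  by rewrite val_enum_ord iota_ltn_sorted.
rewrite -!(nth_map x0 (val x0)) ?size_S //.
by apply: (sorted_ltn_nth ltn_trans) => //; rewrite inE size_map size_S.
Qed.

Lemma card_delete (n r : nat) (S : edge n r.+1) (i : 'I_r.+1) :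
  #|val S :\ vertex S i| == r.
Proof. by have := valP S; rewrite /= (cardsD1 (vertex S i)) vertex_in. Qed.

Definition delete (n r : nat) (S : edge n r.+1) (i : 'I_r.+1) : edge n r :=
  Sub (val S :\ vertex S i) (card_delete S i).

Definition monotone_coloring (n r : nat) (c : coloring n r) : bool :=
  [forall S : edge n r.+1, forall i : 'I_r.+1, forall j : 'I_r.+1,
   forall k : 'I_r.+1, ((i < j)%N && (j < k)%N) ==>
     ((val (c (delete S k)) <= val (c (delete S j)))
        && (val (c (delete S j)) <= val (c (delete S i)))
      || (val (c (delete S k)) >= val (c (delete S j)))
        && (val (c (delete S j)) >= val (c (delete S i))))].

Definition num_monotone (r n : nat) : nat :=
  #|[set c : coloring n r | monotone_coloring c]|.

(* Main.v *)
Require Import Defs.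
From mathcomp Require Import all_boot all_order all_algebra zify.
From mathcomp Require Import all_reals all_analysis.

(** Lower bound: colour an r-set + if the sum of its vertices exceeds T, - if
    it is below T, and arbitrarily if it equals T. By pigeonhole some T is
    attained by at least C(n, r) / (r n) of the r-sets.

    Upper bound: restricting to the first n vertices and taking the link of the
    last one gives S_(r+1)(n+1) <= S_(r+1)(n) S_r(n), which reduces everything
    to S_3(n) <= 2^(n^2). For r = 3, think of a pseudoline arrangement in which
    line i meets a before b, for a < b, iff {i, a, b} is positive; record, for
    each line i, which of its successive crossings are with lines above i.
    These n^2 bits determine the arrangement (Felsner): otherwise take a crossing
    of i and j that comes first among those at which two arrangements with the
    same bits disagree; the equal bits force both to have this crossing next on
    i and next on j. *)

Set Implicit Arguments.
Unset Strict Implicit.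
Unset Printing Implicit Defensive.

(** The first [p] places of [t] are taken by the first [p] entries of [s]: if [x] stands in [t] at
    such a place, the entry [y] of [s] at that place has the same place in [t], so [y = x]. *)
Lemma prefix_index (T : eqType) (s t : seq T) p :
  uniq s -> uniq t -> perm_eq s t ->
  (forall x, index x s < p -> index x t = index x s) ->
  forall x, x \in s -> (index x t < p) = (index x s < p).
Proof.
move=> us ut st agree x sx; apply/idP/idP => [lt|lt]; last by rewrite agree.
have lt_s : index x t < size s by rewrite (perm_size st) index_mem -(perm_mem st).
set y := nth x s (index x t).
have ys : index y s = index x t by rewrite index_uniq.
have yt : index y t = index x t by rewrite -ys; apply: agree; rewrite ys.
have <- : y = x; last by rewrite ys.
by rewrite -(nth_index x (_ : y \in t)) ?yt ?nth_index -?(perm_mem st) ?mem_nth.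
Qed.

(** * Rank 3: pseudoline arrangements and their local sequences *)

Section Triples.
Variable n : nat.
Implicit Types (C D : 'I_n -> 'I_n -> 'I_n -> bool) (i j k m a b : 'I_n).

(** Line [i] meets [a] before [b]. The sign is read reversed when [b < a], so that for symmetric [C]
    exchanging two distinct lines negates the relation. *)
Definition before C i a b := (a < b) == C i a b.

Definition triple_sym C :=
  (forall i a b, C i a b = C a i b) /\ (forall i a b, C i a b = C i b a).

(** This is monotonicity on the 4-set {i, a, b, d}: [i] is the vertex that is not deleted, and it
    may lie anywhere relative to [a < b < d]. *)
Definition triple_mono C := forall i a b d,
  i != a -> i != b -> i != d -> a < b -> b < d ->
  C i a d = C i a b \/ C i a d = C i b d.

Lemma beforeN C i a b : triple_sym C -> a != b -> before C i b a = ~~ before C i a b.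
Proof.
move=> [_ s2] ab; rewrite /before (s2 i b a).
by case: ltngtP ab => [||/val_inj->] //; rewrite ?eqxx //; case: (C i a b).
Qed.

(** On a sorted triple, the sign patterns + - + and - + - that monotonicity excludes are exactly the
    two cyclic orders along line [i]. Six instances of [mC] cover the six possible orders of [a],
    [b], [d]. *)
Lemma before_trans C i a b d : triple_sym C -> triple_mono C ->
  i != a -> i != b -> i != d -> a != b -> b != d -> a != d ->
  before C i a b -> before C i b d -> before C i a d.
Proof.
move=> [_ s2] mC ia ib id ab bd ad.
have := mC i a b d ia ib id; have := mC i a d b ia id ib.
have := mC i b a d ib ia id; have := mC i b d a ib id ia.
have := mC i d a b id ia ib; have := mC i d b a id ib ia.
rewrite /before (s2 i b a) (s2 i d a) (s2 i d b).
case: (ltngtP a b) ab => [||/val_inj->]; rewrite ?eqxx // => ab _;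
case: (ltngtP b d) bd => [||/val_inj->]; rewrite ?eqxx // => bd _;
case: (ltngtP a d) ad => [||/val_inj->]; rewrite ?eqxx // => ad _;
case: (C i a b); case: (C i a d); case: (C i b d) => //= H1 H2 H3 H4 H5 H6;
  try (by case: (H1 isT isT)); try (by case: (H2 isT isT));
  try (by case: (H3 isT isT)); try (by case: (H4 isT isT));
  try (by case: (H5 isT isT)); try (by case: (H6 isT isT));
  try (by have := ltn_trans ab bd; rewrite ltnNge ltnW);
  try (by have := ltn_trans bd ab; rewrite ltnNge ltnW).
Qed.

(* The crossings are acyclically ordered: those that precede the last line m
   ([C x y m] positive), then those on m, then the rest. *)
Lemma minimal_crossing C (P : rel 'I_n) : triple_sym C -> triple_mono C ->
  symmetric P -> irreflexive P -> (exists i j, P i j) ->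
  exists i j, [/\ P i j, forall a, a != j -> P i a -> ~~ before C i a j
                & forall a, a != i -> P j a -> ~~ before C j a i].
Proof.
move=> sC mC; have [s1 s2] := sC.
(* Induction on a bound [N] for the lines occurring in [P]; [P] varies because it may be replaced by
   a subrelation. *)
suff minP N : forall P : rel 'I_n, symmetric P -> irreflexive P ->
    (forall a b, P a b -> a < N) -> (exists i j, P i j) ->
    exists i j, [/\ P i j, forall a, a != j -> P i a -> ~~ before C i a j
                & forall a, a != i -> P j a -> ~~ before C j a i].
  by move=> sP iP; apply: (minP n).
elim: N => [|N IH] {}P sP iP ltP [i0 [j0 P0]]; first by have := ltP _ _ P0.
have irr a b : P a b -> a != b by apply: contraTneq => ->; rewrite iP.
have [/existsP[m /eqP mN]|/existsPn noN] := boolP [exists m : 'I_n, m == N :> nat]; last first.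
  apply: (IH P sP iP) => [a b Pab|]; last by exists i0, j0.
  by rewrite ltn_neqAle -ltnS (ltP _ _ Pab) andbT.
have ltm a b : P a b -> a != m -> a < m.
  by move=> /ltP; rewrite ltnS -mN -val_eqE leq_eqVlt => /orP[->|].
(* The crossings off [m] that come before [m] on both of their lines; as both lines are below [m],
   this is the sign of [C a b m]. *)
pose Pp := [rel a b | [&& P a b, a != m, b != m & C a b m]].
have [/existsP[i /existsP[j Pij]]|/existsPn nPp] :=
    boolP [exists i, exists j, Pp i j].
  have sPp : symmetric Pp by move=> a b /=; rewrite sP s1; case: (a != m); rewrite ?andbF.
  have [|a b /=||i' [j' []]] := IH Pp sPp; first by move=> a /=; rewrite iP.
  - by case/and4P=> /ltm h /h; rewrite mN.
  - by exists i, j.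
  suff half x y : Pp x y -> (forall a, a != y -> Pp x a -> ~~ before C x a y) ->
      forall a, a != y -> P x a -> ~~ before C x a y.
    move=> Pij' h1 h2; exists i', j'; split; first by case/andP: Pij'.
      exact: half.
    by apply: half h2; apply: etrans (sPp _ _) Pij'.
  (* On [x], a crossing with [a] before [y] also comes before [m], so it lies in [Pp] too; [a = m]
     is excluded since [y] comes before [m]. *)
  case/and4P=> Pxy xm ym Cxym h a ay Pxa; apply/negP => xay.
  have ym' : y < m by apply: ltm ym; rewrite sP; apply: Pxy.
  have [am|am] := eqVneq a m.
    by move: xay; rewrite am /before ltnNge ltnW //= s2 Cxym.
  have am' : a < m by apply: ltm am; rewrite sP; apply: Pxa.
  have xym : before C x y m by rewrite /before ym' Cxym.
  have := before_trans sC mC (irr _ _ Pxa) (irr _ _ Pxy) xm ay ym am xay xym.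
  rewrite /before am' eq_sym eqb_id => Cxam.
  by move: (h a ay); rewrite /= Pxa xm am Cxam xay => /(_ isT).
have noPp a b : P a b -> a != m -> b != m -> ~~ C a b m.
  by move=> Pab am bm; move/existsPn: (nPp a) => /(_ b); rewrite /= Pab am bm.
have [/existsP[x0 Px0]|/existsPn nPm] := boolP [exists x, P m x]; last first.
  apply: (IH P sP iP) => [a b Pab|]; last by exists i0, j0.
  by rewrite -mN (ltm _ _ Pab) //; apply: contraTneq Pab => ->.
(* The first crossing on [m] is the one with fewest predecessors: by transitivity, an earlier one
   would have strictly fewer. *)
case: (arg_minnP (fun x => #|[set a | P m a && (a != x) && before C m a x]|) Px0) => x Pmx minx.
have mx := irr _ _ Pmx.
exists m, x; split=> // a ax.
  move=> Pma; apply/negP => max; have ma := irr _ _ Pma.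
  have := minx a Pma; rewrite leqNgt => /negP; apply; apply: proper_card.
  apply/properP; split; last first.
    by exists a; rewrite !inE ?Pma ?ax ?max ?eqxx ?andbF.
  apply/subsetP => b; rewrite !inE => /andP[/andP[Pmb ba] mba]; rewrite Pmb /=.
  have mb := irr _ _ Pmb.
  have bx : b != x.
    by apply: contraTneq mba => ->; rewrite beforeN // max.
  by rewrite bx (before_trans sC mC mb ma mx ba ax bx mba max).
(* A crossing before [m] on [x] would have [C x a m] positive, against [noPp]. *)
move=> Pxa; rewrite /before.
have xm : x != m by rewrite eq_sym.
have am' : a < m by apply: ltm ax; rewrite sP; apply: Pxa.
by rewrite am' eq_sym eqb_id noPp.
Qed.

(** After the lines in [P], line [i] meets [j] in [C] and [k] in [D]; after those in [Q], line [j]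
    meets [i] in [C] and [m] in [D]. If [k] were not [j], line [i] would meet [j] and [k] in
    opposite orders, so {i, j, k} would change sign; every position of [k] and [m] is then
    contradictory. *)
Lemma crossing_agree C D i j k m (P Q : pred 'I_n) :
  triple_sym C -> triple_sym D -> triple_mono D ->
  i < j -> i < k -> m < j ->
  (forall a, a != i -> a != j -> before C i a j = P a) ->
  (forall a, a != i -> a != k -> before D i a k = P a) ->
  (forall a, a != j -> a != i -> before C j a i = Q a) ->
  (forall a, a != j -> a != m -> before D j a m = Q a) ->
  ~~ P j -> ~~ P k -> ~~ Q i -> ~~ Q m ->
  k = j /\ m = i.
Proof.
move=> [c1 c2] [d1 d2] mD ij ik mj CP DP CQ DQ Pj Pk Qi Qm.
have sC := conj c1 c2; have sD := conj d1 d2.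
have neq (x y : 'I_n) : x < y -> x != y by move=> h; rewrite -val_eqE neq_ltn h.
have neq' (x y : 'I_n) : x < y -> y != x by move=> h; rewrite eq_sym neq.
have kj : k = j.
  apply/eqP/negP => /negP nkj.
  have Ck := CP k (neq' _ _ ik) nkj; have Dj := DP j (neq' _ _ ij) ltac:(by rewrite eq_sym).
  rewrite (negbTE Pk) in Ck; rewrite (negbTE Pj) in Dj.
  have [kj|jk|/val_inj e] := ltngtP k j; last by rewrite e eqxx in nkj.
  (* Here [i < k < j]. On line [j] of [D], [i] comes before [k] and [k] before [m], although [i] is
     not in [Q]. *)
  - move: Ck Dj; rewrite /before kj (ltnNge j k) (ltnW kj) /= => Ck Dj.
    have Cjk : before C j k i by rewrite /before ltnNge ltnW //= c2 c1 c2; case: (C i k j) Ck.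
    have Qk : Q k by rewrite -CQ // neq'.
    have km : k != m by apply: contraTneq Qk => ->.
    have Djk : before D j k m by rewrite DQ.
    have Dik : before D j i k by rewrite /before ik d1; case: (D i j k) Dj.
    have [e|im] := eqVneq i m.
      by move: Djk; rewrite -e beforeN ?Dik // neq.
    have := before_trans sD mD (neq' _ _ ij) (neq' _ _ kj) (neq' _ _ mj)
      (neq _ _ ik) km im Dik Djk.
    by rewrite (DQ i (neq _ _ ij) im) (negbTE Qi).
  - have mk := ltn_trans mj jk.
    have Cijk : C i j k by move: Ck; rewrite /before ltnNge ltnW //= c2; case: (C i j k).
    have Dijk : D i j k = false by move: Dj; rewrite /before jk /=; case: (D i j k).
    have Qk : Q k = false.
      by rewrite -(CQ k (neq' _ _ jk) (neq' _ _ ik)) /before ltnNge ltnW //= c2 c1 Cijk.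
    have Djkm := etrans (DQ k (neq' _ _ jk) (neq' _ _ mk)) Qk.
    have mi : m != i.
      apply/eqP => mi; move: Djkm.
      by rewrite mi /before ltnNge ltnW //= d2 d1 Dijk.
    have im : i != m by rewrite eq_sym.
    have Djim := etrans (DQ i (neq _ _ ij) im) (negbTE Qi).
    have Cjmi := etrans (CQ m (neq _ _ mj) mi) (negbTE Qm).
    have Cimj := CP m mi (neq _ _ mj).
    have Dimk := DP m mi (neq _ _ mk).
    have [{}mi|{}im|/val_inj e] := ltngtP m i; last by rewrite e eqxx in mi.
      (* For [m < i < j < k], the signs of [D] on mij, mik, mjk are +, -, +, which is not
         monotone. *)
      have Dmjk : D m j k.
        by move: Djkm; rewrite /before (ltnNge k m) (ltnW mk) /= d2 d1; case: (D m j k).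
      have Dmij : D m i j.
        by move: Djim; rewrite /before (ltnNge i m) (ltnW mi) /= d2 d1 d2; case: (D m i j).
      have Dmik : D m i k = false.
        move: Dimk; rewrite -Cimj; move: Cjmi.
        rewrite /before mi mj mk (c1 j) (c2 m) (c1 m) (d1 i).
        by case: (C i m j) => //; case: (D m i k).
      by case: (mD m i j k (neq _ _ mi) (neq _ _ mj) (neq _ _ mk) ij jk);
        rewrite Dmik ?Dmij ?Dmjk.
    (* For [i < m], line [i] of [D] meets [m] before [k] before [j], so {i, m, j} is positive; but
       [Djim] makes it negative. *)
    have Pm : P m.
      move: Cjmi; rewrite -Cimj /before mj (ltnNge m i) (ltnW im) /=.
      by rewrite c2 c1 c2; case: (C i m j).
    have ikj : before D i k j by rewrite beforeN ?(eq_sym j) // (DP j (neq' _ _ ij)) // eq_sym.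
    have imk : before D i m k by rewrite Dimk.
    have := before_trans sD mD (neq _ _ im) (neq _ _ ik) (neq _ _ ij)
      (neq _ _ mk) nkj (neq _ _ mj) imk ikj.
    move: Djim; rewrite /before mj im d1.
    by rewrite d2; case: (D i m j).
subst k; split=> //.
(* Now [P m] gives {i, j, m} the same sign in [C] and [D], so line [j] meets [i] and [m] in the same
   order in both; [Cjmi] denies one order and [Djim] the other. *)
apply/eqP/negP => /negP mi; have im : i != m by rewrite eq_sym.
have Djim := etrans (DQ i (neq _ _ ij) im) (negbTE Qi).
have Cjmi := etrans (CQ m (neq _ _ mj) mi) (negbTE Qm).
have := DP m mi (neq _ _ mj); rewrite -(CP m mi (neq _ _ mj)).
move: Djim Cjmi; rewrite /before mj (d1 j i) (d2 i j) (c1 j m) (c2 m j) (c1 m i).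
case: (ltngtP i m) im => [||/val_inj->]; rewrite ?eqxx // => _ _;
  by case: (C i m j); case: (D i m j).
Qed.

(* Putting i first makes this a total order on all of 'I_n. *)
Definition along C i := [rel a b | [|| a == b, a == i | (b != i) && before C i a b]].

Definition local_seq C i := sort (along C i) (enum 'I_n).

Lemma along_total C i : triple_sym C -> total (along C i).
Proof.
move=> sC a b /=; have [//|ab] := eqVneq a b.
have [//|ai] := eqVneq a i; have [//|bi] := eqVneq b i; rewrite ?orbT //=.
by rewrite (beforeN i sC ab); case: before.
Qed.

Lemma along_trans C i : triple_sym C -> triple_mono C -> transitive (along C i).
Proof.
move=> sC mC b a d /=.
have [->//|ab] := eqVneq a b; have [<-|bd] := eqVneq b d; first by rewrite ?(negbTE ab).
have [//|ad] := eqVneq a d; have [//|ai] := eqVneq a i; have [//|bi] := eqVneq b i.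
have [//|di] := eqVneq d i; rewrite /= => abi bdi.
by apply: (before_trans sC mC (b := b)); rewrite // eq_sym.
Qed.

Lemma perm_local_seq C i : perm_eq (local_seq C i) (enum 'I_n).
Proof. by rewrite perm_sort. Qed.

Lemma local_seq_uniq C i : uniq (local_seq C i).
Proof. by rewrite (perm_uniq (perm_local_seq C i)) enum_uniq. Qed.

Lemma mem_local_seq C i a : a \in local_seq C i.
Proof. by rewrite (perm_mem (perm_local_seq C i)) mem_enum. Qed.

Lemma size_local_seq C i : size (local_seq C i) = n.
Proof. by rewrite (perm_size (perm_local_seq C i)) size_enum_ord. Qed.

Lemma index_local_seq_inj C i : injective (index^~ (local_seq C i)).
Proof.
move=> a b /= e.
by rewrite -(nth_index a (mem_local_seq C i a)) e nth_index ?mem_local_seq.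
Qed.

Lemma along_index C i a b : triple_sym C -> triple_mono C ->
  index a (local_seq C i) < index b (local_seq C i) -> along C i a b.
Proof.
move=> sC mC; apply: (sorted_ltn_index (along_trans (i := i) sC mC));
  rewrite ?mem_local_seq //.
by apply: sort_sorted; apply: along_total.
Qed.

Lemma before_index C i a b : triple_sym C -> triple_mono C ->
  a != i -> b != i -> a != b ->
  before C i a b = (index a (local_seq C i) < index b (local_seq C i)).
Proof.
move=> sC mC ai bi ab; case: ltngtP => [lt|lt|/index_local_seq_inj e]; last by rewrite e eqxx in ab.
  by have := along_index sC mC lt; rewrite /= (negbTE ab) (negbTE ai) bi.
have := along_index sC mC lt; rewrite /= eq_sym (negbTE ab) (negbTE bi) ai /=.
by rewrite beforeN //; case: before.
Qed.

Lemma index_local_seq_self C i : triple_sym C -> triple_mono C ->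
  index i (local_seq C i) = 0.
Proof.
move=> sC mC; have n_gt0 : 0 < n by apply: leq_ltn_trans (ltn_ord i).
set h := nth i (local_seq C i) 0.
have h0 : index h (local_seq C i) = 0 by rewrite index_uniq ?local_seq_uniq ?size_local_seq.
have [hi|hi] := eqVneq h i; first by rewrite -[X in index X]hi.
have /along_index : index h (local_seq C i) < index i (local_seq C i).
  by rewrite h0 lt0n; apply: contraNneq hi; rewrite -h0 => /index_local_seq_inj->.
by move/(_ sC mC); rewrite /= eqxx (negbTE hi).
Qed.

(* As [local_seq C i] starts with i itself, the entry (i, p) concerns the p-th
   crossing on the pseudoline i for p > 0, and (i, 0) carries no information. *)
Definition replace_matrix C : {ffun 'I_n * 'I_n -> bool} :=
  [ffun ip : 'I_n * 'I_n => ip.1 < nth ip.1 (local_seq C ip.1) ip.2].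

Lemma next_crossing C D i j :
  triple_sym C -> triple_sym D -> triple_mono C -> triple_mono D -> j != i ->
  replace_matrix C = replace_matrix D ->
  (forall a, a != i -> a != j -> before C i a j ->
     index a (local_seq D i) = index a (local_seq C i)) ->
  exists k, exists P : pred 'I_n,
    [/\ k != i, (i < k) = (i < j) & index k (local_seq D i) = index j (local_seq C i)] /\
    [/\ forall a, a != i -> a != j -> before C i a j = P a,
     forall a, a != i -> a != k -> before D i a k = P a, ~~ P j & ~~ P k].
Proof.
move=> sC sD mC mD ji CD agree; set p := index j (local_seq C i).
have pn : p < n by rewrite /p -[X in _ < X](size_local_seq C i) index_mem mem_local_seq.
pose k := nth i (local_seq D i) p; pose P a := index a (local_seq C i) < p.
have ik : index k (local_seq D i) = p by rewrite index_uniq ?local_seq_uniq ?size_local_seq.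
have ki : k != i.
  apply: contraNneq ji => e; apply/eqP/(@index_local_seq_inj C i).
  by rewrite -/p -ik e !index_local_seq_self.
have PE a : (index a (local_seq D i) < p) = P a.
  apply: prefix_index; rewrite ?local_seq_uniq ?mem_local_seq //.
    by rewrite (perm_trans (perm_local_seq _ _)) // perm_sym perm_local_seq.
  move=> b ltb; have [->|bi] := eqVneq b i; first by rewrite !index_local_seq_self.
  have bj : b != j by apply: contraTneq ltb => ->; rewrite ltnn.
  by apply: agree => //; rewrite before_index.
exists k, P; split; split=> //.
- have := congr1 (fun M : {ffun _} => M (i, Ordinal pn)) CD.
  by rewrite !ffunE /= -/k nth_index ?mem_local_seq.
- by move=> a ai aj; rewrite before_index.
- by move=> a ai ak; rewrite before_index // ik.
- by rewrite /P ltnn.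
- by rewrite -PE ik ltnn.
Qed.

Lemma replace_matrix_inj C D :
  triple_sym C -> triple_sym D -> triple_mono C -> triple_mono D ->
  replace_matrix C = replace_matrix D ->
  forall i a b, i != a -> i != b -> a != b -> C i a b = D i a b.
Proof.
move=> sC sD mC mD CD.
(* A crossing counts as displaced if its place changes on at least one of its two lines, which makes
   [P] symmetric. *)
pose dis i j := index j (local_seq C i) != index j (local_seq D i).
pose P := [rel i j | (i != j) && (dis i j || dis j i)].
have sP : symmetric P by move=> i j /=; rewrite eq_sym orbC.
have iP : irreflexive P by move=> i /=; rewrite eqxx.
have [/existsP[i0 /existsP[j0 P0]]|/existsPn noP] := boolP [exists i, exists j, P i j]; last first.
  move=> i a b ia ib ab.
  have agree x : i != x -> index x (local_seq C i) = index x (local_seq D i).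
    move=> ix; move/existsPn: (noP i) => /(_ x); rewrite /= ix /= negb_or /dis.
    by case/andP => /negPn/eqP.
  have : before C i a b = before D i a b.
    by rewrite !before_index ?(eq_sym _ i) // !agree.
  by rewrite /before; case: (_ < _); case: (C i a b); case: (D i a b).
have := minimal_crossing sC mC sP iP (ex_intro _ i0 (ex_intro _ j0 P0)).
suff main i j : i < j -> P i j -> (forall a, a != j -> P i a -> ~~ before C i a j) ->
    (forall a, a != i -> P j a -> ~~ before C j a i) -> False.
  case=> i [j [Pij h1 h2]]; case: (ltngtP i j) => [ij|ji|/val_inj e].
  - by case: (main i j).
  - have Pji : P j i := etrans (sP j i) Pij.
    by case: (main j i ji Pji h2 h1).
  - by move: Pij; rewrite e iP.
move=> ij Pij h1 h2.
have nij : i != j by case/andP: Pij.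
have agree x y : (forall a, a != y -> P x a -> ~~ before C x a y) ->
    forall a, a != x -> a != y -> before C x a y ->
    index a (local_seq D x) = index a (local_seq C x).
  move=> h a ax ay xay; apply/eqP; apply: contraTT xay => ne; apply: h => //=.
  by rewrite eq_sym ax /= /dis eq_sym ne.
have [|k [Pi [[ki ik ek] [CP DP Pj Pk]]]] := next_crossing sC sD mC mD _ CD (agree i j h1).
  by rewrite eq_sym.
have [m [Q [[mj jm em] [CQ DQ Qi Qm]]]] := next_crossing sC sD mC mD nij CD (agree j i h2).
(* The bits on line [j] agree, so [m] lies below [j] just as [i] does. *)
have lt_mj : m < j.
  by rewrite ltn_neqAle [_ != _]mj leqNgt jm -leqNgt ltnW.
rewrite ij in ik.
(* The crossing of [i] and [j] thus has the same place on both lines, so it was not displaced. *)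
have [e e'] := crossing_agree sC sD mD ij ik lt_mj CP DP CQ DQ Pj Pk Qi Qm.
by case/andP: Pij => _; rewrite /dis -ek -em e e' !eqxx.
Qed.
End Triples.

(** * Colorings as families of positive sets *)

(** With only two colors, three signs are monotone exactly when the middle one equals an outer one,
    so membership in [F] can stand for the color. *)
Definition monotone_family (n r : nat) (F : {set {set 'I_n}}) : bool :=
  [forall S : {set 'I_n}, (#|S| == r.+1) ==>
    [forall x in S, forall y in S, forall z in S, (x < y < z) ==>
      (((S :\ y \in F) == (S :\ x \in F)) || ((S :\ y \in F) == (S :\ z \in F)))]].

Definition signotopes (n r : nat) : {set {set {set 'I_n}}} :=
  [set F : {set {set 'I_n}} | [forall A in F, #|A| == r] && monotone_family r F].

Lemma monotone_familyP n r (F : {set {set 'I_n}}) :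
  reflect (forall (S : {set 'I_n}) x y z, #|S| = r.+1 ->
             x \in S -> y \in S -> z \in S -> x < y -> y < z ->
             (S :\ y \in F) = (S :\ x \in F) \/ (S :\ y \in F) = (S :\ z \in F))
          (monotone_family r F).
Proof.
apply: (iffP forallP) => [mF S x y z cS xS yS zS xy yz|mF S].
  have := mF S; rewrite cS eqxx => /forall_inP/(_ x xS)/forall_inP/(_ y yS).
  by move/forall_inP/(_ z zS); rewrite xy yz => /orP[]/eqP; [left|right].
apply/implyP => /eqP cS; apply/forall_inP => x xS; apply/forall_inP => y yS.
apply/forall_inP => z zS; apply/implyP => /andP[xy yz].
by case: (mF S x y z cS xS yS zS xy yz) => ->; rewrite eqxx ?orbT.
Qed.

Lemma signotopesP n r (F : {set {set 'I_n}}) :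
  reflect ((forall A, A \in F -> #|A| = r) /\ monotone_family r F) (F \in signotopes n r).
Proof.
rewrite inE; apply: (iffP andP) => -[u m]; split=> //.
  by move=> A AF; apply/eqP; apply: (forall_inP u).
by apply/forall_inP => A AF; apply/eqP; apply: u.
Qed.

Definition positive (x : color) : bool := (val x == 1)%R.

Definition positive_color : color := SeqSub (isT : (1 : int)%R \in [:: -1; 1 : int]%R).
Definition negative_color : color := SeqSub (isT : (-1 : int)%R \in [:: -1; 1 : int]%R).

Lemma positive_inj : injective positive.
Proof.
move=> [x xP] [y yP]; rewrite /positive /= => e; apply: val_inj => /=.
by move: xP yP e; rewrite !inE => /orP[]/eqP-> /orP[]/eqP->.
Qed.

Lemma between_positive (x y z : color) :
  ((val x <= val y)%R && (val y <= val z)%R || (val x >= val y)%R && (val y >= val z)%R)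
  = ((positive y == positive z) || (positive y == positive x)).
Proof.
case: x y z => [x xP] [y yP] [z zP]; rewrite /positive /=.
by move: xP yP zP; rewrite !inE => /orP[]/eqP-> /orP[]/eqP-> /orP[]/eqP->.
Qed.

Definition positive_edges n r (c : coloring n r) : {set {set 'I_n}} :=
  [set val e | e in [pred e | positive (c e)]].

Lemma mem_positive_edges n r (c : coloring n r) e :
  (val e \in positive_edges c) = positive (c e).
Proof. by rewrite mem_imset //; apply: val_inj. Qed.

Lemma positive_edges_inj n r : injective (@positive_edges n r).
Proof.
move=> c d e; apply/ffunP => A; apply: positive_inj.
by rewrite -!mem_positive_edges e.
Qed.

Lemma vertex_surj n m (S : edge n m) x : x \in val S -> exists i, vertex S i = x.
Proof.
move=> xS; exists (cast_ord (eqP (valP S)) (enum_rank_in xS x)).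
by rewrite /vertex cast_ordK enum_rankK_in.
Qed.

Lemma vertex_ltE n m (S : edge n m) (i j : 'I_m) : (vertex S i < vertex S j) = (i < j).
Proof.
case: (ltngtP i j) => [/(vertex_lt S)->//|/(vertex_lt S)|/val_inj->].
  by move=> /ltnW; rewrite leqNgt => /negbTE.
by rewrite ltnn.
Qed.

(** [vertex S] is an increasing bijection, so indices [i < j < k] and elements [x < y < z] of [S]
    are interchangeable. *)
Lemma monotone_coloringE n r (c : coloring n r) :
  monotone_coloring c = monotone_family r (positive_edges c).
Proof.
have posE S i : val S :\ vertex S i \in positive_edges c = positive (c (delete S i)).
  by rewrite -mem_positive_edges.
apply/idP/monotone_familyP => [mc S0 x y z cS|mF].
  pose S : edge n r.+1 := Sub S0 (introT eqP cS).
  rewrite -[S0]/(val S).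
  move=> /vertex_surj[i <-] /vertex_surj[j <-] /vertex_surj[k <-].
  rewrite !vertex_ltE => ij jk.
  move/forallP/(_ S)/forallP/(_ i)/forallP/(_ j)/forallP/(_ k): mc.
  rewrite ij jk between_positive !posE.
  by case/orP => /eqP->; [left|right].
apply/forallP => S; apply/forallP => i; apply/forallP => j; apply/forallP => k.
apply/implyP => /andP[ij jk]; rewrite between_positive -!posE.
have := mF (val S) (vertex S i) (vertex S j) (vertex S k) (eqP (valP S)).
rewrite !vertex_in !vertex_ltE => /(_ isT isT isT ij jk)[]->; by rewrite eqxx ?orbT.
Qed.

Lemma num_monotoneE r n : num_monotone r n = #|signotopes n r|.
Proof.
rewrite /num_monotone -(card_imset _ (@positive_edges_inj n r)); congr #|pred_of_set _|.
apply/setP => F; apply/imsetP/signotopesP => [[c]|[uF mF]].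
  rewrite inE monotone_coloringE => mc ->; split=> // A /imsetP[e _ ->].
  exact: eqP (valP e).
pose c : coloring n r := [ffun e => if val e \in F then positive_color else negative_color].
suff FE : F = positive_edges c by exists c; rewrite // inE monotone_coloringE -FE.
have posE e : positive (c e) = (val e \in F) by rewrite ffunE; case: ifP.
apply/setP => A; apply/idP/imsetP => [AF|[e]].
  by exists (Sub A (introT eqP (uF A AF))); rewrite ?inE /= ?posE.
by rewrite inE posE => ? ->.
Qed.

(** * The bound 2^(n^2) in rank 3 *)

Lemma cards3P (T : finType) (A : {set T}) : #|A| = 3 ->
  exists x y z, [/\ x != y, x != z, y != z & A = [set x; y; z]].
Proof.
move=> cA; have /card_gt0P[x xA] : 0 < #|A| by rewrite cA.
have /cards2P[y [z [yz Ax]]] : #|A :\ x| == 2.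
  by move: cA; rewrite (cardsD1 x) xA add1n => -[->].
have : x \notin A :\ x by rewrite setD11.
rewrite Ax !inE negb_or => /andP[xy xz].
by exists x, y, z; split; rewrite // -setUA -Ax setD1K.
Qed.

Definition triple_color n (F : {set {set 'I_n}}) (i a b : 'I_n) := [set i; a; b] \in F.

Lemma triple_color_sym n (F : {set {set 'I_n}}) : triple_sym (triple_color F).
Proof.
split=> i a b; rewrite /triple_color; first by rewrite (setUC [set i]).
by rewrite -!setUA (setUC [set a]).
Qed.

Lemma triple_color_mono n (F : {set {set 'I_n}}) :
  monotone_family 3 F -> triple_mono (triple_color F).
Proof.
move/monotone_familyP=> mF i a b d ia ib id ab bd; have ad := ltn_trans ab bd.
have [nab nbd nad] : [/\ a != b, b != d & a != d] by rewrite -!val_eqE !neq_ltn ab bd ad.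
pose S := [set i; a; b; d].
have cS : #|S| = 4.
  by rewrite /S -!setUA !cardsU1 !inE !negb_or ia ib id nab nbd nad cards1.
have := mF S a b d cS; rewrite !inE !eqxx !orbT => /(_ isT isT isT ab bd).
have [-> -> ->] : [/\ S :\ a = [set i; b; d], S :\ b = [set i; a; d] & S :\ d = [set i; a; b]].
  split; apply/setP => x; rewrite !inE.
  - have [->|] := eqVneq x a; last by rewrite orbF.
    by rewrite ![a == _]eq_sym (negbTE ia) eq_sym (negbTE nab) eq_sym (negbTE nad).
  - have [->|] := eqVneq x b; last by rewrite orbF.
    by rewrite [b == i]eq_sym (negbTE ib) [b == a]eq_sym (negbTE nab) (negbTE nbd).
  - have [->|] := eqVneq x d; last by rewrite orbF.
    by rewrite ![d == _]eq_sym (negbTE id) (negbTE nad) (negbTE nbd).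
by rewrite /triple_color; case; [right|left].
Qed.

Lemma card_signotopes3 n : #|signotopes n 3| <= 2 ^ (n ^ 2).
Proof.
have inj : {in signotopes n 3 &, injective (fun F => replace_matrix (triple_color F))}.
  move=> F G /signotopesP[uF mF] /signotopesP[uG mG] /= FG.
  have FGE := replace_matrix_inj (triple_color_sym F) (triple_color_sym G)
    (triple_color_mono mF) (triple_color_mono mG) FG.
  apply/setP => A; have [cA|cA] := eqVneq #|A| 3; last first.
    by apply/idP/idP => [/uF|/uG] /eqP; rewrite (negbTE cA).
  have [x [y [z [nxy nxz nyz ->]]]] := cards3P cA.
  by apply: FGE.
rewrite -(card_in_imset inj) (leq_trans (max_card _)) //.
by rewrite card_ffun card_bool card_prod card_ord.
Qed.

(** * Upper bound: removing the last vertex *)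

Definition restriction n (F : {set {set 'I_n.+1}}) : {set {set 'I_n}} :=
  [set A : {set 'I_n} | lift ord_max @: A \in F].

Definition link_max n (F : {set {set 'I_n.+1}}) : {set {set 'I_n}} :=
  [set A : {set 'I_n} | ord_max |: lift ord_max @: A \in F].

Lemma imset_liftD1 n (m : 'I_n.+1) (S : {set 'I_n}) x :
  lift m @: (S :\ x) = (lift m @: S) :\ lift m x.
Proof.
apply/setP => y; rewrite !inE; apply/imsetP/andP => [[z]|[yx /imsetP[z zS yz]]].
  rewrite !inE => /andP[zx zS] ->; split; last exact: imset_f.
  by rewrite (inj_eq lift_inj).
by exists z => //; rewrite !inE zS andbT -(inj_eq (@lift_inj _ m)) -yz.
Qed.

Lemma imset_lift_max n (S : {set 'I_n}) : ord_max \notin lift ord_max @: S.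
Proof. by apply/imsetP => -[x _ /eqP]; rewrite (negbTE (neq_lift _ _)). Qed.

Lemma lift_max_lt n (x y : 'I_n) : (lift ord_max x < lift ord_max y) = (x < y).
Proof. by rewrite !lift_max. Qed.

Lemma restriction_signotope n r F :
  F \in signotopes n.+1 r -> restriction F \in signotopes n r.
Proof.
move=> /signotopesP[uF /monotone_familyP mF]; apply/signotopesP; split.
  by move=> A; rewrite inE => /uF; rewrite card_imset //; apply: lift_inj.
apply/monotone_familyP => S x y z cS xS yS zS xy yz.
rewrite !inE !imset_liftD1; apply: mF; rewrite ?imset_f ?lift_max_lt //.
by rewrite card_imset //; apply: lift_inj.
Qed.

(** Deleting a vertex of [S] commutes with adding the last vertex, so monotonicity of the link on
    [S] is monotonicity of [F] on [S] with the last vertex added. *)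
Lemma link_max_signotope n r F :
  F \in signotopes n.+1 r.+1 -> link_max F \in signotopes n r.
Proof.
have cardU (A : {set 'I_n}) : #|ord_max |: lift ord_max @: A| = #|A|.+1.
  by rewrite cardsU1 imset_lift_max card_imset //; apply: lift_inj.
move=> /signotopesP[uF /monotone_familyP mF]; apply/signotopesP; split.
  by move=> A; rewrite inE => /uF; rewrite cardU => -[].
have delU (S : {set 'I_n}) x : ord_max |: lift ord_max @: (S :\ x)
    = (ord_max |: lift ord_max @: S) :\ lift ord_max x.
  rewrite imset_liftD1; apply/setP => y; rewrite !inE.
  by case: eqVneq => //= ->; rewrite neq_lift.
apply/monotone_familyP => S x y z cS xS yS zS xy yz.
rewrite !inE !delU; apply: mF; rewrite ?cardU ?cS ?lift_max_lt //.
all: by rewrite !inE imset_f ?orbT.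
Qed.

(** The restriction records the sets that avoid the last vertex, the link those that contain it. *)
Lemma restriction_link_inj n (F G : {set {set 'I_n.+1}}) :
  restriction F = restriction G -> link_max F = link_max G -> F = G.
Proof.
move=> /setP eR /setP eL; apply/setP => A.
have imA : lift ord_max @: (lift ord_max @^-1: A) = A :\ (ord_max : 'I_n.+1).
  apply/setP => y; rewrite !inE; case: (unliftP ord_max y) => [x ->|->].
    by rewrite mem_imset ?inE 1?eq_sym ?neq_lift //; apply: lift_inj.
  by rewrite eqxx (negbTE (imset_lift_max _)).
have [mA|mA] := boolP ((ord_max : 'I_n.+1) \in A).
  by have := eL (lift ord_max @^-1: A); rewrite !inE imA setD1K.
have := eR (lift ord_max @^-1: A); rewrite !inE imA.
have -> : A :\ (ord_max : 'I_n.+1) = A; last by [].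
by apply/setDidPl; rewrite disjoint_sym disjoints1.
Qed.

Lemma card_signotopes_vertex n r :
  #|signotopes n.+1 r.+1| <= #|signotopes n r.+1| * #|signotopes n r|.
Proof.
have inj : injective (fun F => (@restriction n F, link_max F)).
  by move=> F G [/restriction_link_inj h /h].
rewrite -cardsX -(card_imset _ inj).
apply/subset_leq_card/subsetP => _ /imsetP[F Fs ->].
by rewrite inE /= restriction_signotope ?link_max_signotope.
Qed.

(** The two leading terms of the binomial expansion; this adds up the exponents when a vertex is
    added. *)
Lemma leq_expS_succ n k : n ^ k.+1 + k.+1 * n ^ k <= n.+1 ^ k.+1.
Proof.
elim: k => [|k IH]; first by rewrite !expn0 !expn1 addn1.
rewrite [n.+1 ^ _]expnS; apply: leq_trans (leq_mul (leqnn _) IH).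
rewrite !(expnS n); move: (n ^ k) => a; nia.
Qed.

Lemma card_signotopes_empty r : #|signotopes 0 r.+1| <= 1.
Proof.
rewrite -(cards1 (set0 : {set {set 'I_0}})); apply/subset_leq_card/subsetP => F.
move/signotopesP => [uF _]; rewrite inE; apply/eqP/setP => A; rewrite inE.
apply/negP => /uF; have := max_card (mem A); rewrite card_ord => /[swap] ->.
by [].
Qed.

(** The factorial power clears the denominator of the exponent. Induction on the rank, then on [n],
    starting from rank 3. *)
Lemma leq_card_signotopes n r :
  #|signotopes n r.+3| ^ (r.+2)`! <= 2 ^ (2 ^ r.+1 * n ^ r.+2).
Proof.
elim: r n => [|r IHr] n.
  by rewrite mulnC expnM leq_exp2r // card_signotopes3.
elim: n => [|n IHn].
  apply: (@leq_trans (1 ^ (r.+3)`!)); last by rewrite exp1n expn_gt0.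
  by rewrite leq_exp2r ?fact_gt0 ?card_signotopes_empty.
apply: leq_trans (_ : (#|signotopes n r.+4| * #|signotopes n r.+3|) ^ (r.+3)`! <= _).
  by rewrite leq_exp2r ?fact_gt0 // card_signotopes_vertex.
apply: leq_trans (_ : 2 ^ (2 ^ r.+2 * n ^ r.+3) * 2 ^ (2 ^ r.+1 * n ^ r.+2 * r.+3) <= _).
  rewrite expnMn leq_mul // factS [_ * (_)`!]mulnC expnM [2 ^ (_ * r.+3)]expnM.
  by rewrite leq_exp2r.
(* The coefficient [2 ^ r.+1] of the second term is raised to [2 ^ r.+2], so that [leq_expS_succ]
   applies. *)
rewrite -expnD leq_exp2l // (leq_trans _ (leq_mul (leqnn _) (leq_expS_succ _ _))) //.
rewrite mulnDr leq_add2l (mulnC r.+3) -mulnA leq_mul // leq_exp2l //.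
Qed.

(** * Lower bound: levels of the vertex sum *)

Definition weight n (A : {set 'I_n}) : nat := \sum_(x in A) x.

Definition level n r T : {set {set 'I_n}} := [set A : {set 'I_n} | #|A| == r & weight A == T].

(* The r-subsets of an (r+1)-set have distinct weights, so at most one of them
   has an arbitrary sign. *)
Lemma level_signotope n r T (X : {set {set 'I_n}}) : X \subset level n r T ->
  X :|: [set A : {set 'I_n} | #|A| == r & T < weight A] \in signotopes n r.
Proof.
move=> /subsetP XT; apply/signotopesP; split.
  by move=> A; rewrite !inE => /orP[/XT|]; rewrite ?inE => /andP[/eqP].
apply/monotone_familyP => S x y z cS xS yS zS xy yz.
have wD u : u \in S -> weight S = u + weight (S :\ u).
  by move=> uS; rewrite /weight (big_setD1 u).
have cD u : u \in S -> #|S :\ u| == r.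
  by move=> uS; move: cS; rewrite (cardsD1 u) uS add1n => -[->].
have XE u : u \in S -> weight (S :\ u) != T -> S :\ u \in X = false.
  by move=> uS wu; apply: contraNF wu => /XT; rewrite inE => /andP[].
have := wD x xS; have := wD y yS; have := wD z zS.
rewrite !inE !cD //=; set wx := weight (S :\ x); set wy := weight (S :\ y).
set wz := weight (S :\ z) => ez ey ex.
have [ltyx ltzy] : wy < wx /\ wz < wy by clear -ex ey ez xy yz; lia.
(* Below [T], the sets without [y] and without [z] are both negative; above [T], those without [x]
   and without [y] are both positive; at [T] the outer two have opposite signs, so either sign fits
   in the middle. *)
have [ltT|gtT|eT] := ltngtP wy T.
- have ltzT := ltn_trans ltzy ltT.
  right; rewrite (XE y) ?(XE z) -/wy -/wz ?neq_ltn ?ltT ?ltzT //.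
  by rewrite ltnNge (ltnW ltzT).
- by left; rewrite (ltn_trans gtT ltyx) !orbT.
- rewrite -eT in XE *; rewrite (XE x) ?(XE z) -/wx -/wz ?neq_ltn ?ltyx ?ltzy ?orbT //.
  by rewrite [wy < wz]ltnNge (ltnW ltzy); case: (_ \in X); [left|right].
Qed.

(** Each subset [X] of the level gives its own signotope, as [X] is recovered as the part of weight
    [T]. *)
Lemma leq_level_signotopes n r T : 2 ^ #|level n r T| <= #|signotopes n r|.
Proof.
pose f (X : {set {set 'I_n}}) := X :|: [set A : {set 'I_n} | #|A| == r & T < weight A].
have inj : {in powerset (level n r T) &, injective f}.
  move=> X Y; rewrite !inE => /subsetP XT /subsetP YT XY; apply/setP => A.
  have := congr1 (fun F : {set {set 'I_n}} => A \in F) XY; rewrite !inE.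
  have [|wA] := eqVneq (weight A) T; first by move=> ->; rewrite ltnn andbF !orbF.
  by move=> _; apply/idP/idP => [/XT|/YT]; rewrite inE (negbTE wA) andbF.
rewrite -card_powerset -(card_in_imset inj); apply/subset_leq_card/subsetP => _ /imsetP[X XT ->].
by apply: level_signotope; rewrite -powersetE.
Qed.

Lemma weight_lt n (A : {set 'I_n}) : 0 < #|A| -> weight A < #|A| * n.
Proof.
move=> A0; apply: (@leq_trans (\sum_(x in A) n)); last by rewrite sum_nat_const.
have [x xA] := card_gt0P A0.
rewrite /weight (big_setD1 x xA) [leqRHS](big_setD1 x xA) /= -addSn leq_add //.
by apply: leq_sum => y _; rewrite ltnW.
Qed.

Lemma large_level n r : 0 < r -> exists T, 'C(n, r) <= r * n * #|level n r T|.
Proof.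
move=> r0.
(* For [n = 0] there is no weight below [r * n] to maximize over, but the binomial vanishes. *)
case: n => [|n]; first by exists 0; rewrite bin0n eqn0Ngt r0.
have [|T maxT] := @eq_bigmax 'I_(r * n.+1) (fun T => #|level n.+1 r T|).
  by rewrite card_ord muln_gt0 r0.
exists (nat_of_ord T); rewrite -maxT.
apply: (@leq_trans (\sum_(T' < r * n.+1) #|level n.+1 r T'|)); last first.
  apply: (@leq_trans (\sum_(T' < r * n.+1) \max_(i < r * n.+1) #|level n.+1 r i|)); last first.
    by rewrite sum_nat_const card_ord.
  by apply: leq_sum => T' _; apply: (@leq_bigmax _ (fun i : 'I_(r * n.+1) => #|level n.+1 r i|)).
rewrite (eq_bigr (fun T' : 'I_(r * n.+1) =>
    \sum_(A : {set 'I_n.+1} | #|A| == r) (weight A == T'))); last first.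
  move=> T' _; rewrite -sum1_card big_mkcond [RHS]big_mkcond /=.
  by apply: eq_bigr => A _; rewrite inE; case: (#|A| == r).
have -> : 'C(n.+1, r) = \sum_(A : {set 'I_n.+1} | #|A| == r) 1.
  by rewrite sum1dep_card card_draws card_ord.
(* Double counting: each r-set lies in the level of its own weight. *)
rewrite exchange_big /=.
apply: leq_sum => A /eqP cA.
have wA : weight A < r * n.+1 by rewrite -cA weight_lt ?cA.
by rewrite (bigD1 (Ordinal wA)) //= eqxx.
Qed.

(** This is (n/r)^r <= C(n, r) without division. The induction uses (n+1)/(r+1) <= n/r, valid for r
    <= n, and (n+1) C(n, r) = (r+1) C(n+1, r+1). *)
Lemma leq_exp_bin n r : r <= n -> n ^ r <= r ^ r * 'C(n, r).
Proof.
elim: r n => [|r IH] [|n] //.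
rewrite ltnS => rn; have [->|r0] := posnP r; first by rewrite bin1 expn1 mul1n.
have : r ^ r * n.+1 ^ r <= r ^ r * (r.+1 ^ r * 'C(n, r)).
  rewrite mulnCA (leq_trans _ (leq_mul (leqnn _) (IH n rn))) // -!expnMn leq_exp2r //.
  by rewrite mulnC; lia.
rewrite leq_pmul2l ?expn_gt0 ?r0 // => h.
by rewrite expnS (expnS r.+1) -mulnA (mulnCA r.+1) -mul_bin_diag mulnCA leq_mul2l h orbT.
Qed.

Unset Implicit Arguments.
Import Order.TTheory GRing.Theory Num.Theory.

Local Open Scope ring_scope.

(** * Real exponents and the two bounds *)

Lemma le_powR_root (R : realType) (x : R) (N f : nat) :
  0 <= x -> (0 < f)%N -> x ^+ f <= 2 ^+ N -> x <= 2 `^ (N%:R / f%:R).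
Proof.
move=> x0 f0 xN; rewrite -(ler_pXn2r f0) ?nnegrE ?powR_ge0 //.
by rewrite -[leRHS]powR_mulrn ?powR_ge0 // -powRrM divfK ?pnatr_eq0 -?lt0n // powR_mulrn.
Qed.

Theorem theorem2p2 (R : realType) (r n : nat) (hr : (3 <= r)%N)
    (hn : (r <= n)%N) :
  (2 : R) `^ (n%:R ^+ (r - 1) / r%:R ^+ (4 * r)) <= (num_monotone r n)%:R
  /\ (num_monotone r n)%:R <=
     (2 : R) `^ (2 ^+ (r - 2) * n%:R ^+ (r - 1) / ((r - 1)`!)%:R).
Proof.
rewrite num_monotoneE; split; last first.
  case: r hr hn => [|[|[|k]]] // _ _; rewrite !subSS !subn0.
  have := leq_card_signotopes n k; rewrite -(ler_nat R) !natrX => le_k.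
  by have := le_powR_root _ _ _ _ (ler0n _ _) (fact_gt0 _) le_k; rewrite natrM !natrX.
have r_gt0 : (0 < r)%N by apply: leq_trans hr.
have n_gt0 : (0 < n)%N by apply: leq_trans hn.
have [T large] := large_level n r_gt0.
apply: (@le_trans _ _ (2 `^ #|level n r T|%:R)); last first.
  by rewrite powR_mulrn // -natrX ler_nat leq_level_signotopes.
rewrite ler_powR ?ler1n // ler_pdivrMr ?exprn_gt0 ?ltr0n //.
rewrite -!natrX -natrM ler_nat.
(* Combine n^r <= r^r C(n, r) with C(n, r) <= r n |level| and cancel one factor [n]. *)
have n_leq : (n ^ (r - 1) <= r ^ r.+1 * #|level n r T|)%N.
  rewrite -(leq_pmul2l n_gt0) -expnS subn1 prednK //.
  apply: leq_trans (leq_exp_bin hn) (leq_trans (leq_mul (leqnn _) large) _).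
  by rewrite expnSr -!mulnA !(mulnCA n).
(* The exponent [4 * r] leaves room to spare: [r.+1 <= 2 * r] already suffices. *)
apply: leq_trans n_leq _; rewrite mulnC leq_mul // leq_pexp2l //.
by rewrite (leq_trans (_ : r.+1 <= 2 * r)%N) ?leq_mul // mul2n -addnn -addn1 leq_add2l.
Qed.
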